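(* Let $k\in\mathbb{N}$ and $S=\langle 6k+5,6k+7,6k+11\rangle$. Then \[\mathrm{Ap}(S,6k+5)=\{a(6k+7)+b(6k+11)\mid (a,b)\in C\},\] where $C=\big(\{0,1,2\}\times\{0,1,\dots,2k+1\}\big)\setminus\{(2,2k+1)\}$.
   Context: $\mathbb{N}=\{0,1,2,\dots\}$. For $X\subseteq\mathbb{N}$, $\langle X\rangle$ is the submonoid of $(\mathbb{N},+)$ generated by $X$; here it is a numerical semigroup (a submonoid of $\mathbb{N}$ with finite complement). For a numerical semigroup $S$ and $n\in S\setminus\{0\}$, the Apéry set is $\mathrm{Ap}(S,n)=\{s\in S\mid s-n\notin S\}$. *)

(* Defs.v *)
From mathcomp Require Import all_boot.
From mathcomp Require Import all_classical.

Set Implicit Arguments.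
Unset Strict Implicit.
Unset Printing Implicit Defensive.

Local Open Scope classical_set_scope.

Definition submonoid (M : set nat) : Prop :=
  M 0 /\ forall x y, M x -> M y -> M (x + y).

Definition submonoid_gen (X : set nat) : set nat := smallest submonoid X.

(* The difference s - n is meant in the integers, so that s - n is not in S
   when s < n; the guard n <= s is needed because nat subtraction truncates.
   The definition is total, but of interest when S is a numerical semigroup
   and n is a nonzero element of S. *)
Definition Apery (S : set nat) (n : nat) : set nat :=
  [set s | S s /\ ~ (n <= s /\ S (s - n))].

(* Main.v *)
Require Import Defs.
From mathcomp Require Import all_boot.
From mathcomp Require Import all_classical.
From mathcomp Require Import zify.

(** Write n = 6k+5, p = n+2 and q = n+6. The relations 3p = 2n + q,
    (2k+2)q = (2k+3)n + p and 2p + (2k+1)q = (2k+5)n force any element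
    ap + bq of the Apéry set to have (a, b) in C. Conversely, for (a, b) in C
    suppose that ap + bq = xn + cp + dq with x > 0. Since
    ap + bq = (a+b)n + 2(a+3b), where n is odd and a+3b < n, there is v >= 0
    with c+3d = a+3b + vn and a+b = x+c+d + 2v. This is impossible, because
    a <= 2 keeps a+b close to (a+3b)/3, while c+d >= (c+3d)/3. *)

Local Open Scope classical_set_scope.

Lemma submonoid_gen3P (n p q s : nat) :
  submonoid_gen [set n; p; q] s <->
  exists x a b, s = x * n + a * p + b * q.
Proof.
split.
- move=> /(_ [set t | exists x a b, t = x * n + a * p + b * q]); apply; split.
    split; first by exists 0, 0, 0.
    move=> _ _ [x [a [b ->]]] [y [c [d ->]]].
    by exists (x + y), (a + c), (b + d); rewrite !mulnDl; lia.
  move=> t [[->|->]|->].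
  + by exists 1, 0, 0; lia.
  + by exists 0, 1, 0; lia.
  + by exists 0, 0, 1; lia.
- move=> [x [a [b ->]]] M [[M0 MD] XM].
  have MX y c : [set n; p; q] y -> M (c * y).
    move=> Xy; elim: c => [|c IHc]; first exact: M0.
    by rewrite mulSn; apply: MD; [apply: XM|].
  apply: (MD _ _ (MD _ _ _ _)); apply: MX.
  + by left; left.
  + by left; right.
  + by right.
Qed.

(** Adding or removing one copy of [n] turns the condition on [s - n] into one on representations of
    [s], free of subtraction. *)
Lemma Apery_submonoid_gen3P (n p q s : nat) :
  Apery (submonoid_gen [set n; p; q]) n s <->
  (exists a b, s = a * p + b * q) /\
  (forall x a b, s <> x.+1 * n + a * p + b * q).
Proof.
split.
- move=> [/submonoid_gen3P [x [a [b es]]] nS].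
  have notS y c d : s <> y.+1 * n + c * p + d * q.
    move=> es'; apply: nS; rewrite es' mulSn -!addnA; split; first exact: leq_addr.
    by apply/submonoid_gen3P; exists y, c, d; rewrite addKn addnA.
  split=> //; exists a, b; case: x es => [|x] es; first by rewrite es.
  by case: (notS x a b).
- move=> [[a [b es]] notS]; split.
    by apply/submonoid_gen3P; exists 0, a, b; rewrite es.
  move=> [le_ns /submonoid_gen3P [x [c [d e]]]].
  by apply: (notS x c d); rewrite mulSn -!addnA -(subnKC le_ns) e !addnA.
Qed.

Lemma no_smaller_representation (k a b x c d : nat) :
  a <= 2 -> a + 3 * b < 6 * k + 5 ->
  a * (6 * k + 7) + b * (6 * k + 11) <>
  x.+1 * (6 * k + 5) + c * (6 * k + 7) + d * (6 * k + 11).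
Proof.
move=> a2 ltn e.
have e' : (a + b) * (6 * k + 5) + 2 * (a + 3 * b) =
    (x.+1 + c + d) * (6 * k + 5) + 2 * (c + 3 * d) by lia.
have [lt|le] := ltnP (a + b) (x.+1 + c + d).
  (* A gap of at least 2 contradicts [2 * (a + 3 * b) < 2 * (6 * k + 5)]; a gap of 1 fails by
     parity. *)
  have : 2 <= (x.+1 + c + d) - (a + b) \/ (x.+1 + c + d) = (a + b).+1 by lia.
  case=> [le2|E]; last by move: e'; rewrite E; lia.
  have := leq_mul le2 (leqnn (6 * k + 5)).
  by rewrite mulnBl; lia.
have [t et] : exists t, a + b = x.+1 + c + d + t.
  by exists (a + b - (x.+1 + c + d)); lia.
have e2 : 2 * (c + 3 * d) = 2 * (a + 3 * b) + t * (6 * k + 5).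
  by move: e'; rewrite et [(_ + t) * _]mulnDl; lia.
(* For [t = 0], a - c = 3(d - b) and a - c > d - b, so d > b and a >= 3. *)
case: t et e2 => [|t] et e2; first by lia.
(* From 6(c+d) >= 2(c+3d) one would get 4a >= 6(x+1) + (t+1)(6k+11) > 8. *)
have : 6 * k + 5 <= t.+1 * (6 * k + 5) by rewrite leq_pmull.
by lia.
Qed.

Theorem theorem8 (k : nat) :
  let S : set nat := submonoid_gen [set 6 * k + 5; 6 * k + 7; 6 * k + 11] in
  let C : set (nat * nat) :=
    ([set 0; 1; 2] `*` [set b | b <= 2 * k + 1]) `\ (2, 2 * k + 1) in
  Apery S (6 * k + 5) =
    [set ab.1 * (6 * k + 7) + ab.2 * (6 * k + 11) | ab in C].
Proof.
move=> S C; apply/seteqP; split=> s.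
- move=> /Apery_submonoid_gen3P [[a [b es]] notS].
  have a2 : a <= 2.
    (* Trade 3p for 2n + q; the first argument of [notS] is one less than the number of copies of
       n. *)
    rewrite leqNgt; apply/negP => a3; apply: (notS 1 (a - 3) b.+1).
    have -> : s = (a - 3 + 3) * (6 * k + 7) + b * (6 * k + 11) by rewrite subnK.
    by lia.
  have b2 : b <= 2 * k + 1.
    rewrite leqNgt; apply/negP => b3.
    (* Trade (2k+2)q for (2k+3)n + p. *)
    apply: (notS (2 * k + 2) a.+1 (b - (2 * k + 2))).
    have -> : s = a * (6 * k + 7) + (b - (2 * k + 2) + (2 * k + 2)) * (6 * k + 11).
      by rewrite subnK //; lia.
    by lia.
  exists (a, b) => //=; split.
    split=> //=.
    case: a a2 {es} => [|[|[|//]]] _; by [left; left|left; right|right].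
  move=> [ea eb]; apply: (notS (2 * k + 4) 0 0); rewrite es ea eb.
  by lia.
- move=> [[a b] [[/= aC bC] nC] <-].
  have a2 : a <= 2 by case: aC => [[->|->]|->].
  (* On the full rectangle, a + 3b reaches 6k+5 only at the removed corner. *)
  have ltn : a + 3 * b < 6 * k + 5.
    suff : ~ (a = 2 /\ b = 2 * k + 1) by lia.
    by move=> [ea eb]; apply: nC; rewrite ea eb.
  apply/Apery_submonoid_gen3P; split; first by exists a, b.
  by move=> x c d; apply: no_smaller_representation.
Qed.
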